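(* Let $G=(V,E)$ be any unweighted undirected graph on $n$ vertices and let $k\ge 1$ be an integer. There is an emulator $H$ for $G$ with $|H| = O\!\left(n^{1+\frac{1}{2^{k+1}-1}}\right)$ and stretch function $f(d) = d + (4+o(1))k\,d^{1-1/k}$; that is, for all $u,v\in V$, $\dist_G(u,v)\le \dist_H(u,v)\le \dist_G(u,v) + (4+o(1))k\,\dist_G(u,v)^{1-1/k}$.
   Context: An emulator of an unweighted graph $G=(V,E)$ is a set $H$ of weighted edges on vertex set $V$ (not necessarily edges of $G$) such that $\dist_H(u,v)\in[\dist_G(u,v), f(\dist_G(u,v))]$ for all $u,v\in V$, where $f$ is the stretch function and $\dist$ denotes shortest-path distance (in $H$ using only the weighted edges of $H$). *)

(* Defs.v *)
From HB Require Import structures.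
From mathcomp Require Import all_boot all_order all_algebra.
From mathcomp Require Import all_classical all_reals all_analysis.
Set Implicit Arguments.
Unset Strict Implicit.
Unset Printing Implicit Defensive.
Import Order.TTheory GRing.Theory Num.Theory.
Import numFieldNormedType.Exports.
Local Open Scope classical_set_scope.
Local Open Scope ring_scope.

(* Among parallel edges only the lightest matters for distances, so a set of
   weighted edges is given by its underlying edges and one weight per edge;
   the values of [weight] outside [edges] are irrelevant. *)
Record wgraph (R : realType) (T : finType) := WGraph {
  edges : {set {set T}};
  weight : {set T} -> R;
  edges_card2 : forall a, a \in edges -> #|a| = 2%N;
  weight_gt0 : forall a, a \in edges -> 0 < weight a
}.

Definition wadj (R : realType) (T : finType) (H : wgraph R T) : rel T :=
  [rel x y | [set x; y]%SET \in edges H].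

(* [zip (u :: p) p] lists the consecutive pairs of the walk [u :: p]. *)
Definition walk_weight (R : realType) (T : finType) (H : wgraph R T)
    (u : T) (p : seq T) : R :=
  \sum_(xy <- zip (u :: p) p) weight H [set xy.1; xy.2]%SET.

(* In both distances the infimum over no walk at all is [+oo]. *)
Definition gdist (R : realType) (T : finType) (e : rel T) (u v : T) : \bar R :=
  ereal_inf [set (size p)%:R%:E | p in [set p | path e u p /\ last u p = v]].

Definition wdist (R : realType) (T : finType) (H : wgraph R T) (u v : T) :
    \bar R :=
  ereal_inf [set (walk_weight H u p)%:E
            | p in [set p | path (wadj H) u p /\ last u p = v]].

(* When [u] and [v] are not connected in the graph, the first inequality makes
   them unconnected in [H], and the upper bound is read as [+oo]. *)
Definition emulator (R : realType) (T : finType) (e : rel T) (H : wgraph R T)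
    (f : nat -> R) : Prop :=
  forall u v : T,
    (gdist R e u v <= wdist H u v)%E /\
    (forall d : nat, gdist R e u v = d%:R%:E -> (wdist H u v <= (f d)%:E)%E).

(* Main.v *)
(* The emulator is that of Thorup and Zwick. Choose vertex sets
   A_0 = V, A_1, ..., A_k, A_(k+1) = set0 of decreasing sizes, and join each u in
   A_i, by an edge weighted with the distance, to the vertices of A_i that are
   strictly closer to u than all of A_(i+1), and to a vertex of A_(i+1) nearest
   to u. Thus for u, v in A_i either uv is an edge, or some edge leads from u to
   A_(i+1) without being longer than the distance from u to v.
   For the stretch, cut a shortest path of length at most r ^ (i + 1) into r
   pieces of length at most r ^ i. If some pieces cannot be followed cheaply at
   level i, climb to A_(i+1) at the first and at the last of them and use the
   alternative above between the two vertices reached. A path of length r ^ k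
   consists of r ^ (k - 1 - i) paths of length r ^ (i + 1), and each of them costs
   about 4 r ^ i at level i: this makes 4 r ^ (k - 1) for each of k levels, with r
   close to the k-th root of the distance. *)
Require Import Defs.
From HB Require Import structures.
From mathcomp Require Import all_boot all_order all_algebra.
From mathcomp Require Import all_classical all_reals all_analysis.
From mathcomp Require Import zify ring lra.
Set Implicit Arguments.
Unset Strict Implicit.
Unset Printing Implicit Defensive.
Import Order.TTheory GRing.Theory Num.Theory.
Import numFieldNormedType.Exports.

(** * Bunches and the choice of the next level *)

Definition bunch (T : finType) (d : T -> T -> nat) (A A' : {set T}) (v : T) :
    {set T} :=
  [set u in A | [forall w in A', d v u < d v w]].

(** Inside [B] at most one order of each pair is counted, which gives at most half of [#|B| ^ 2];
    each [x] outside [B] contributes at most [#|B|]. *)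
Lemma sum_card_below (T : finType) (f : T -> nat) (A B : {set T}) :
  B \subset A ->
  2 * \sum_(x in A) #|[set u in B | f u < f x]| + #|B| ^ 2 <= 2 * #|A| * #|B|.
Proof.
move=> sBA.
have splitA : \sum_(x in A) #|[set u in B | f u < f x]| <=
    #|A :\: B| * #|B| + \sum_(x in B) #|[set u in B | f u < f x]|.
  rewrite (big_setID B) /= (finset.setIidPr sBA) addnC leq_add2r -sum_nat_const.
  by apply: leq_sum => x _; apply/subset_leq_card/fintype.subsetP => u;
    rewrite inE => /andP[].
have swap : \sum_(x in B) #|[set u in B | f u < f x]| =
    \sum_(x in B) #|[set u in B | f x < f u]|.
  have card_sum (P : rel T) x : #|[set u in B | P x u]| = \sum_(u in B) P x u.
    rewrite -sum1_card (eq_bigl (fun u => (u \in B) && P x u)); last first.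
      by move=> u; rewrite inE.
    by rewrite -big_mkcondr.
  rewrite (eq_bigr _ (fun x _ => card_sum (fun x u => f u < f x) x)).
  rewrite [RHS](eq_bigr _ (fun x _ => card_sum (fun x u => f x < f u) x)).
  by rewrite exchange_big.
have inB : 2 * \sum_(x in B) #|[set u in B | f u < f x]| <= #|B| * #|B|.
  rewrite mul2n -addnn {2}swap -big_split /= -sum_nat_const.
  apply: leq_sum => x _; rewrite -cardsUI.
  rewrite [X in _ + #|pred_of_set X|](_ : _ = finset.set0) ?cards0 ?addn0.
    apply/subset_leq_card/fintype.subsetP => u; rewrite !inE.
    by case/orP => /andP[].
  by apply/finset.setP => u; rewrite !inE; lia.
have := cardsID B A; rewrite (finset.setIidPr sBA) => cA.
move: splitA inB; rewrite -cA expnS expn1; nia.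
Qed.

(** Cauchy-Schwarz, by summing 2 f(v) f(w) <= f(v)^2 + f(w)^2 over all pairs. *)
Lemma sqr_sum_le (T : finType) (A : {set T}) (f : T -> nat) :
  (\sum_(v in A) f v) ^ 2 <= #|A| * \sum_(v in A) f v ^ 2.
Proof.
have E : \sum_(v in A) \sum_(w in A) (f v ^ 2 + f w ^ 2) =
    2 * (#|A| * \sum_(v in A) f v ^ 2).
  under eq_bigr do rewrite big_split /= sum_nat_const.
  by rewrite big_split /= sum_nat_const -big_distrr /=; lia.
rewrite -(leq_pmul2l (isT : 0 < 2)) -E expnS expn1 big_distrl /= big_distrr /=.
apply: leq_sum => v _; rewrite big_distrr big_distrr /=.
by apply: leq_sum => w _; rewrite [2 * _]mulnA -mulnA; apply: nat_Cauchy.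
Qed.

(* Adding a uniformly random element of [A] to [A'] lowers the average bunch
   size [S / m] by [S ^ 2 / (2 m ^ 3)]; some element does at least as well. *)
Lemma small_bunches (T : finType) (d : T -> T -> nat) (A : {set T}) (r : nat) :
  exists A' : {set T}, #|A'| <= r /\
    r.+2 * \sum_(v in A) #|bunch d A A' v| <= 2 * #|A| ^ 2.
Proof.
have [->|/finset.set0Pn[x0 x0A]] := eqVneq A finset.set0.
  by exists finset.set0; rewrite cards0 big_set0 muln0.
elim: r => [|r [A' [cA' IH]]].
  exists finset.set0; rewrite cards0; split=> //.
  rewrite leq_pmul2l // expnS expn1 -sum_nat_const; apply: leq_sum => v _.
  by apply/subset_leq_card/fintype.subsetP => u; rewrite inE => /andP[].
pose b v := #|bunch d A A' v|.
(* [b' x v] is the size of the bunch of [v] once [x] has joined [A']. *)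
pose b' x v := #|[set u in bunch d A A' v | d v u < d v x]|.
have [x xA minx] : exists2 x, x \in A &
    forall y, y \in A -> \sum_(v in A) b' x v <= \sum_(v in A) b' y v.
  by case: (arg_minnP (fun x => \sum_(v in A) b' x v) x0A) => x ? ?; exists x.
exists (x |: A'); split.
  by rewrite cardsU1; case: (x \notin A') => /=; lia.
have -> : \sum_(v in A) #|bunch d A (x |: A') v| = \sum_(v in A) b' x v.
  apply: eq_bigr => v _; congr #|pred_of_set _|; apply/finset.setP => u; rewrite !inE.
  rewrite -andbA; congr (_ && _); apply/forall_inP/andP => [H|[/forall_inP H Hx] w].
    split; last by apply: H; rewrite setU11.
    by apply/forall_inP => w wA; apply: H; rewrite setU1r.
  by rewrite !inE => /orP[/eqP->|/H].
have avg : #|A| * \sum_(v in A) b' x v <= \sum_(v in A) \sum_(y in A) b' y v.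
  by rewrite exchange_big /= -sum_nat_const; apply: leq_sum => y /minx.
have sumb : 2 * \sum_(v in A) \sum_(y in A) b' y v + \sum_(v in A) b v ^ 2 <=
    2 * #|A| * \sum_(v in A) b v.
  rewrite !big_distrr -big_split /=; apply: leq_sum => v _.
  by apply: sum_card_below; apply/fintype.subsetP => u; rewrite inE => /andP[].
have CS := sqr_sum_le A b.
have mgt0 : 0 < #|A| by apply/card_gt0P; exists x0.
move: IH CS avg sumb mgt0; rewrite -[\sum_(v in A) #|bunch d A A' v|]/(\sum_(v in A) b v).
move: (\sum_(v in A) b v) (\sum_(v in A) b' x v) => S S'.
move: (\sum_(v in A) b v ^ 2) (\sum_(v in A) \sum_(y in A) b' y v) => Q W.
move: #|A| => m IH CS avg sumb m0.
have key : 2 * m ^ 2 * S' + S ^ 2 <= 2 * m ^ 2 * S.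
  have : m * (2 * W + Q) <= m * (2 * m * S) by rewrite leq_mul2l sumb orbT.
  have : m * (m * S') <= m * W by rewrite leq_mul2l avg orbT.
  by rewrite !expnS !expn0 in CS *; lia.
have M0 : 0 < 2 * m ^ 2 by rewrite muln_gt0 expn_gt0 m0.
rewrite -(leq_pmul2l M0).
move: (2 * m ^ 2) M0 IH key => M M0 IH key.
(* What remains is (r + 3) S (M - S) <= M^2, given (r + 2) S <= M; with M = (r + 2) S + t it is a
   comparison of coefficients. *)
have [t Mt] : exists t, M = r.+2 * S + t by exists (M - r.+2 * S); lia.
have : r.+3 * (M * S' + S ^ 2) <= r.+3 * (M * S) by rewrite leq_mul2l key orbT.
by rewrite expnS expn1; nia.
Qed.

(** * Walks of bounded length *)

Definition walk_le (T : finType) (e : rel T) (u v : T) (m : nat) : Prop :=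
  exists p, [/\ path e u p, last u p = v & size p <= m].

Lemma walk_le_trans (T : finType) (e : rel T) (u v w : T) (m m' : nat) :
  walk_le e u v m -> walk_le e v w m' -> walk_le e u w (m + m').
Proof.
move=> [p [ep <- sp]] [q [eq <- sq]]; exists (p ++ q).
by rewrite cat_path ep eq last_cat size_cat leq_add.
Qed.

Lemma walk_le_sym (T : finType) (e : rel T) (u v : T) (m : nat) :
  symmetric e -> walk_le e u v m -> walk_le e v u m.
Proof.
move=> esym [p [ep <- sp]]; exists (rev (belast u p)); split.
- by rewrite rev_path (eq_path (e' := e)) // => x y; rewrite esym.
- by case: p {ep sp} => //= y p; rewrite rev_cons last_rcons.
- by rewrite size_rev size_belast.
Qed.

Lemma walk_le_mono (T : finType) (e : rel T) (u v : T) (m m' : nat) :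
  m <= m' -> walk_le e u v m -> walk_le e u v m'.
Proof. by move=> le [p [? ? sp]]; exists p; split=> //; apply: leq_trans le. Qed.

Lemma walk_le_split (T : finType) (e : rel T) (u v : T) (a b : nat) :
  walk_le e u v (a + b) -> exists2 z, walk_le e u z a & walk_le e z v b.
Proof.
move=> [p [ep <- sp]]; exists (last u (take a p)).
  exists (take a p); split=> //; last by rewrite size_take; case: ltnP.
  by move: ep; rewrite -{1}(cat_take_drop a p) cat_path => /andP[].
exists (drop a p); split.
- by move: ep; rewrite -{1}(cat_take_drop a p) cat_path => /andP[].
- by rewrite -last_cat cat_take_drop.
- by rewrite size_drop leq_subLR.
Qed.

(** * Surplus along a path, level by level *)

(* The pair (b, g) bounds the cost of following a path of length at most r ^ i:
   either its ends are joined with surplus b, or its start reaches A_(i+1) at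
   cost g. *)
Fixpoint stretch_bounds (r i : nat) : nat * nat :=
  if i is j.+1 then
    let: (b, g) := stretch_bounds r j in
    (r * b + 4 * g, r ^ i + r * b + 3 * g)
  else (0, 1).

(* [h u v m] stands for a walk of weight at most [m] in the emulator. *)
Record weighted_walk (T : finType) (e : rel T) (h : T -> T -> nat -> Prop) :=
  WeightedWalk {
  ww_refl : forall u, h u u 0;
  ww_sym : forall u v m, h u v m -> h v u m;
  ww_trans : forall u v w m m', h u v m -> h v w m' -> h u w (m + m');
  ww_mono : forall u v m m', m <= m' -> h u v m -> h u v m';
  ww_walk : forall u v m, h u v m -> walk_le e u v m }.

(** Pieces of length at most [L] are followed from [u] until one fails, at [x]: [j] pieces of total
    length [a] are done with surplus [b] each. The remaining [c] fits in [s - j] pieces, so that a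
    second search can start from [v]. *)
Lemma first_bad_segment (T : finType) (e : rel T) (h : T -> T -> nat -> Prop)
    (D : {set T}) (L b g : nat) :
  weighted_walk e h ->
  (forall u v m, m <= L -> walk_le e u v m ->
    h u v (m + b) \/ exists2 w, w \in D & h u w g) ->
  forall s u v m, m <= s * L -> walk_le e u v m ->
  h u v (m + s * b) \/
  exists a c j x w, [/\ a + c <= m, j <= s /\ c <= (s - j) * L, walk_le e x v c,
    h u x (a + j * b) & w \in D /\ h x w g].
Proof.
move=> hh P; elim=> [|s IH] u v m ms uv.
  left; have m0 : m = 0 by lia.
  case: uv => p [_ <- sp]; have /size0nil -> : size p = 0 by lia.
  by rewrite m0; apply: ww_refl hh _.
have [mL|Lm] := leqP m L.
  have [uv'|[w wD uw]] := P _ _ _ mL uv.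
    by left; apply: (ww_mono hh) uv'; rewrite leq_add2l mulSn leq_addr.
  right; exists 0, m, 0, u, w; split=> //.
  exact: ww_refl hh _.
have [z uz zv] : exists2 z, walk_le e u z L & walk_le e z v (m - L).
  by apply: walk_le_split; rewrite subnKC // ltnW.
have [uz'|[w wD uw]] := P _ _ _ (leqnn L) uz; last first.
  right; exists 0, m, 0, u, w; split=> //.
  exact: ww_refl hh _.
have [|zv'|[a [c [j [x [w [acm [js cj] xv zx wD]]]]]]] := IH z v (m - L) _ zv.
- by move: ms; rewrite mulSn; lia.
- left; apply: (ww_mono hh) (ww_trans hh uz' zv').
  by rewrite mulSn; lia.
- right; exists (L + a), c, j.+1, x, w; split=> //; first lia.
  apply: (ww_mono hh) (ww_trans hh uz' zx); rewrite mulSn; lia.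
Qed.

Lemma stretch_level (T : finType) (e : rel T) (h : T -> T -> nat -> Prop)
    (A : nat -> {set T}) (k r : nat) :
  symmetric e -> weighted_walk e h -> A 0 = [set: T]%SET ->
  (forall i u v m, i <= k -> u \in A i -> v \in A i -> walk_le e u v m ->
    h u v m \/ exists2 w, w \in A i.+1 & h u w m) ->
  forall i, i <= k -> forall u v m, m <= r ^ i -> walk_le e u v m ->
  h u v (m + (stretch_bounds r i).1) \/
  exists2 w, w \in A i.+1 & h u w (stretch_bounds r i).2.
Proof.
move=> esym hh A0 cover; elim=> [|i IH] ik u v m mr uv.
  have [||uv'|[w wA uw]] := cover 0 u v m isT _ _ uv; rewrite ?A0 ?inE //.
    by left; rewrite addn0.
  by right; exists w => //; apply: (ww_mono hh) uw.
move: IH mr => /(_ (ltnW ik)) /=.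
case: (stretch_bounds r i) => b g /= IH mr.
have H := first_bad_segment hh IH.
have [|uv'|[a [c [j [x [w [acm [js cj] xv ux [wA xw]]]]]]]] := H r u v m _ uv.
- by rewrite -expnS.
- by left; apply: (ww_mono hh) uv'; lia.
(* The second search goes backwards from [v] over what is left. Its cuts may differ from the first
   ones, so it may meet no failing piece; then it arrives at [x]. *)
have [|vx|[a' [c' [j' [y [w' [acm' [js' cj'] yx vy [wA' yw']]]]]]]] :=
    H (r - j) v x c cj _.
- exact: walk_le_sym.
- left; apply: (ww_mono hh) (ww_trans hh ux (ww_sym hh vx)).
  by rewrite -{2}(subnKC js) mulnDl; lia.
have jb : j * b + j' * b <= r * b by rewrite -mulnDl leq_mul2r; lia.
have ww' : walk_le e w w' (g + c' + g).
  apply: walk_le_trans (ww_walk hh yw').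
  apply: walk_le_trans (ww_walk hh (ww_sym hh xw)) _.
  exact: walk_le_sym.
have uw := ww_trans hh ux xw.
have [hww'|[z zA wz]] := cover i.+1 w w' _ ik wA wA' ww'.
(* The four [g]: two climbs, and twice [g] in the bound on the length of a walk between [w] and
   [w']. *)
- left; apply: (ww_mono hh) (ww_trans hh uw (ww_trans hh hww'
    (ww_trans hh (ww_sym hh yw') (ww_sym hh vy)))).
  by lia.
(* The climb between [w'] and [y] is not paid here, whence [3 * g]. *)
- by right; exists z => //; apply: (ww_mono hh) (ww_trans hh uw wz); lia.
Qed.

(** The surplus is at most 4 i r^(i-1) + c r^(i-2) and the climb at most r^i + c r^(i-1): each level
    multiplies the surplus by [r] and adds four climbs. Multiplying out avoids negative
    exponents. *)
Lemma stretch_bounds_asymp (i : nat) : exists c : nat, forall r : nat, 0 < r ->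
  r ^ 2 * (stretch_bounds r i).1 <= r ^ i * (4 * i * r + c) /\
  r * (stretch_bounds r i).2 <= r ^ i * (r + c).
Proof.
elim: i => [|i [c IH]].
  by exists 0 => r r0 /=; lia.
(* The surplus needs [5 * c], the climb [4 * i + 3 + 4 * c]. *)
exists (4 * i + 3 + 5 * c) => r r0; have /= := IH r r0.
case: (stretch_bounds r i) => b g /= [Hb Hg].
rewrite !expnS !expn0 !muln1 in Hb *.
move: (r ^ i) Hb Hg => q Hb Hg; split.
  have : r * (r * r * b) <= r * (q * (4 * i * r + c)) by rewrite leq_mul2l Hb orbT.
  have : 4 * r * (r * g) <= 4 * r * (q * (r + c)) by rewrite leq_mul2l Hg orbT.
  by nia.
have : q * c <= r * q * c by rewrite -mulnA leq_pmull.
by nia.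
Qed.

(** * Graph distance as a natural number *)

(* The value is [#|T|] when [u] and [v] are not connected. *)
Definition dist (T : finType) (e : rel T) (u v : T) : nat :=
  find (fun m => [exists p : m.-tuple T, path e u p && (last u p == v)])
    (iota 0 #|T|).

Lemma dist_walk (T : finType) (e : rel T) (u v : T) :
  (dist e u v < #|T|)%N -> walk_le e u v (dist e u v).
Proof.
move=> lt; have := lt; rewrite -{1}(size_iota 0 #|T|) -has_find.
move=> /(nth_find 0%N); rewrite -/(dist e u v) nth_iota // add0n.
by case/existsP => p /andP[ep /eqP lp]; exists p; rewrite size_tuple.
Qed.

(** A walk shortens to one without repeated vertices, which has fewer than [#|T|] steps, so the
    bounded search in [dist] misses nothing. *)
Lemma walk_dist (T : finType) (e : rel T) (u v : T) (m : nat) :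
  walk_le e u v m -> (dist e u v <= m)%N /\ (dist e u v < #|T|)%N.
Proof.
move=> [p [ep <-]]; case/shortenP: ep => q eq uq qp sp.
have sq : (size q < #|T|)%N by have := max_card (mem (u :: q)); rewrite (card_uniqP uq).
suff dq : (dist e u (last u q) <= size q)%N.
  split; last exact: leq_ltn_trans sq.
  apply: leq_trans dq (leq_trans _ sp).
  by apply: uniq_leq_size qp; case/andP: uq.
rewrite leqNgt; apply/negP => /(before_find 0%N).
rewrite nth_iota // add0n => /negbT/negP; apply.
by apply/existsP; exists (in_tuple q); rewrite eq eqxx.
Qed.

Lemma dist_sym (T : finType) (e : rel T) (u v : T) :
  symmetric e -> dist e u v = dist e v u.
Proof.
move=> esym; apply: eq_find => m.
wlog suff: u v / [exists p : m.-tuple T, path e u p && (last u p == v)] ->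
    [exists p : m.-tuple T, path e v p && (last v p == u)].
  by move=> H; apply/idP/idP; apply: H.
case/existsP => p /andP[ep /eqP lp]; apply/existsP.
have sz : size (rev (belast u p)) == m by rewrite size_rev size_belast size_tuple.
exists (Tuple sz) => /=; rewrite -lp rev_path (eq_path (e' := e)); last first.
  by move=> x y; rewrite esym.
rewrite ep /=; case: (tval p) => //= y q.
by rewrite rev_cons last_rcons.
Qed.

Lemma dist_gt0 (T : finType) (e : rel T) (u v : T) :
  (dist e u v < #|T|)%N -> u != v -> (0 < dist e u v)%N.
Proof.
move=> /dist_walk[p [_ <- sp]]; apply: contraNT; rewrite -leqNgt leqn0 => /eqP d0.
by move: sp; rewrite d0 leqn0 size_eq0 => /eqP ->.
Qed.

Local Open Scope ring_scope.

Lemma gdistE (R : realType) (T : finType) (e : rel T) (u v : T) :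
  gdist R e u v =
  if (dist e u v < #|T|)%N then (dist e u v)%:R%:E else +oo%E.
Proof.
case: ifP => [/dist_walk[p [ep lp sp]]|nd]; last first.
  apply/eqP; rewrite -leye_eq; apply: le_ereal_inf_tmp => _ [p [ep lp] <-].
  have [|_] := @walk_dist _ e u v (size p); last by rewrite nd.
  by exists p.
apply/eqP; rewrite eq_le; apply/andP; split.
  have /walk_dist[le _] : walk_le e u v (size p) by exists p.
  have -> : dist e u v = size p by apply/eqP; rewrite eqn_leq le sp.
  by apply: ereal_inf_lbound; exists p.
apply: le_ereal_inf_tmp => _ [q [eq lq] <-]; rewrite lee_fin ler_nat.
by have /walk_dist[] : walk_le e u v (size q) by exists q.
Qed.

(** * The hierarchy of vertex sets *)

(** [S u] is the bunch of [u] plus one vertex of [A'] nearest to [u], if any. [small_bunches] with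
    [Num.truncn a] bounds the bunches, as [(Num.truncn a).+2] exceeds [a]; the nearest vertices add
    at most [#|A|]. *)
Lemma next_level (R : realType) (T : finType) (d : T -> T -> nat)
    (A : {set T}) (a : R) : 0 < a ->
  exists (A' : {set T}) (S : T -> {set T}),
  [/\ #|A'|%:R <= a,
    (\sum_(v in A) #|S v|)%N%:R <= 2 * #|A|%:R ^+ 2 / a + #|A|%:R &
    forall u v, u \in A -> v \in A -> v \in S u \/
      exists2 w, w \in A' & (d u w <= d u v)%N /\ w \in S u].
Proof.
move=> a0; have [A' [cA' sumB]] := small_bunches d A (Num.truncn a).
have /andP[ra ar] := truncn_itv (ltW a0).
pose near u := [pick w in A' | [forall w' in A', d u w <= d u w']%N].
exists A', (fun u => bunch d A A' u :|: [set w | near u == Some w]); split.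
- by apply: le_trans ra; rewrite ler_nat.
- have le1 : (\sum_(v in A) #|bunch d A A' v :|: [set w | near v == Some w]| <=
      \sum_(v in A) #|bunch d A A' v| + #|A|)%N.
    rewrite -[X in (_ <= _ + X)%N]sum1_card -big_split; apply: leq_sum => v _.
    rewrite cardsU (leq_trans (leq_subr _ _)) // leq_add2l.
    case: (near v) => [w|]; last first.
      by rewrite eq_card0 // => x; rewrite !inE.
    by rewrite -(cards1 w); apply/subset_leq_card/fintype.subsetP => x;
      rewrite !inE => /eqP[->].
  apply: le_trans (_ : (\sum_(v in A) #|bunch d A A' v| + #|A|)%N%:R <= _).
    by rewrite ler_nat.
  rewrite natrD lerD2r ler_pdivlMr //.
  have : ((Num.truncn a).+2 * \sum_(v in A) #|bunch d A A' v|)%N%:R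
    <= (2 * #|A| ^ 2)%N%:R :> R by rewrite ler_nat.
  rewrite !natrM -expr2; apply: le_trans; rewrite mulrC ler_wpM2r //.
  by apply: (le_trans (ltW ar)); rewrite ler_nat.
- move=> u v uA vA; have [vB|] := boolP (v \in bunch d A A' u).
    by left; rewrite inE vB.
  rewrite inE vA /= negb_forall_in => /exists_inP[w wA']; rewrite -leqNgt => dwv.
  right; have : near u != None.
    rewrite /near; case: pickP => // nope.
    case: (arg_minnP (d u) wA') => w0 w0A min0.
    have /negP := negbT (nope w0); case; rewrite (w0A : w0 \in A') /=.
    by apply/forall_inP => w' /min0.
  rewrite /near; case: pickP => // w0 /andP[w0A /forall_inP min0] _.
  exists w0 => //; split; first exact: leq_trans (min0 _ wA') dwv.
  by rewrite !inE /near; apply/orP; right; apply/eqP.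
Qed.

Lemma hierarchy (R : realType) (T : finType) (d : T -> T -> nat) (a : nat -> R) :
  (forall i, 0 < a i) -> #|T|%:R <= a 0 ->
  exists (A : nat -> {set T}) (S : nat -> T -> {set T}),
  [/\ A 0 = [set: T]%SET, forall i, #|A i|%:R <= a i,
    forall i, (\sum_(v in A i) #|S i v|)%N%:R <=
      2 * #|A i|%:R ^+ 2 / a i.+1 + #|A i|%:R &
    forall i u v, u \in A i -> v \in A i -> v \in S i u \/
      exists2 w, w \in A i.+1 & (d u w <= d u v)%N /\ w \in S i u].
Proof.
move=> a0 Ta.
(* Choosing for all pairs of an index and a set lets [A] be defined by recursion, each level from
   the previous one. *)
have lev (x : nat * {set T}) : exists y : {set T} * (T -> {set T}),
   [/\ #|y.1|%:R <= a x.1.+1,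
    (\sum_(v in x.2) #|y.2 v|)%N%:R <= 2 * #|x.2|%:R ^+ 2 / a x.1.+1 + #|x.2|%:R &
    forall u v, u \in x.2 -> v \in x.2 -> v \in y.2 u \/
      exists2 w, w \in y.1 & (d u w <= d u v)%N /\ w \in y.2 u].
  by have [A' [S H]] := next_level d x.2 (a0 x.1.+1); exists (A', S).
have [f fP] := choice lev.
pose A := fix A i := if i is j.+1 then (f (j, A j)).1 else [set: T]%SET.
exists A, (fun i => (f (i, A i)).2); split=> //.
- by case=> [|i]; [rewrite /= cardsT|have [] := fP (i, A i)].
- by move=> i; have [] := fP (i, A i).
- by move=> i u v; have [_ _] := fP (i, A i); apply.
Qed.

(** * The weighted graph of the hierarchy *)

(** Weights live on unordered pairs; the maximum recovers the distance without ordering the two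
    vertices, since the diagonal terms are 0. *)
Definition pair_weight (R : realType) (T : finType) (d : T -> T -> nat)
  (a : {set T}) : R := (\max_(x in a) \max_(y in a) d x y)%N%:R.

Lemma pair_weightE (R : realType) (T : finType) (d : T -> T -> nat) (x y : T) :
  (forall u, d u u = 0%N) -> (forall u v, d u v = d v u) -> x != y ->
  pair_weight R d [set x; y]%SET = (d x y)%:R.
Proof.
move=> d0 dsym xy; rewrite /pair_weight !big_setU1 ?inE //= !big_set1.
by rewrite !big_setU1 ?inE //= !big_set1 !d0 (dsym y) max0n maxn0 maxnn.
Qed.

Lemma dist_refl (T : finType) (e : rel T) (u : T) : dist e u u = 0%N.
Proof.
have [|le _] := @walk_dist _ e u u 0; first by exists [::].
by apply/eqP; rewrite -leqn0.
Qed.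

Lemma distance_graph (R : realType) (T : finType) (e g : rel T) :
  symmetric e -> (forall x y, g x y -> x != y /\ (dist e x y < #|T|)%N) ->
  exists H : wgraph R T,
    edges H = [set [set xy.1; xy.2]%SET | xy in [pred xy | g xy.1 xy.2]]%SET /\
    weight H = pair_weight R (dist e).
Proof.
move=> esym gP; pose E := [set [set xy.1; xy.2]%SET | xy in [pred xy | g xy.1 xy.2]]%SET.
have c2 a : a \in E -> #|a| = 2%N.
  by case/imsetP => -[x y] /= /gP[xy _] ->; rewrite cards2 xy.
have w0 a : a \in E -> 0 < pair_weight R (dist e) a.
  case/imsetP => -[x y] /= /gP[xy dxy] ->.
  rewrite pair_weightE //; [|exact: dist_refl|by move=> *; exact: dist_sym].
  by rewrite ltr0n dist_gt0.
by exists (WGraph c2 w0).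
Qed.

Definition wwalk_le (R : realType) (T : finType) (H : wgraph R T) (u v : T)
    (m : nat) : Prop :=
  exists p, [/\ path (wadj H) u p, last u p = v & walk_weight H u p <= m%:R].

Lemma walk_weight_cat (R : realType) (T : finType) (H : wgraph R T) (u : T)
    (p q : seq T) :
  walk_weight H u (p ++ q) = walk_weight H u p + walk_weight H (last u p) q.
Proof.
elim: p u => [|x p IH] u /=; first by rewrite {2}/walk_weight /= big_nil add0r.
by have := IH x; rewrite /walk_weight /= !big_cons -addrA => ->.
Qed.

Lemma wwalk_le_sym (R : realType) (T : finType) (H : wgraph R T) (u v : T)
    (m : nat) : wwalk_le H u v m -> wwalk_le H v u m.
Proof.
suff rev_walk p : path (wadj H) u p -> exists q,
    [/\ path (wadj H) (last u p) q, last (last u p) q = u &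
      walk_weight H (last u p) q = walk_weight H u p].
  by move=> [p [ep <- wp]]; have [q [eq lq wq]] := rev_walk p ep; exists q; rewrite wq.
elim: p u => [|x p IH] u /=; first by exists [::].
move=> /andP[ux /IH[q [eq lq wq]]]; exists (q ++ [:: u]).
have xu : wadj H x u by rewrite /wadj /= finset.setUC.
rewrite cat_path last_cat eq lq /= xu; split=> //.
rewrite walk_weight_cat lq wq /walk_weight /= !big_cons big_nil /= addr0 addrC.
by rewrite finset.setUC.
Qed.

(** Replacing each edge by a shortest path gives a walk of [e] no longer than the weight; hence
    distances cannot shrink. *)
Lemma walk_weight_nat (R : realType) (T : finType) (e : rel T) (H : wgraph R T) :
  (forall x y, wadj H x y ->
    (dist e x y < #|T|)%N /\ weight H [set x; y]%SET = (dist e x y)%:R) ->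
  forall u p, path (wadj H) u p ->
  exists2 m, walk_weight H u p = m%:R & walk_le e u (last u p) m.
Proof.
move=> Hw u p; elim: p u => [|x p IH] u /=.
  by move=> _; exists 0%N; [rewrite /walk_weight big_nil|exists [::]].
move=> /andP[/Hw[dux wux] /IH[m' wm' pm']]; exists (dist e u x + m')%N.
  by rewrite natrD -wux -wm' /walk_weight /= big_cons.
exact: walk_le_trans (dist_walk dux) pm'.
Qed.

Lemma wwalk_weighted_walk (R : realType) (T : finType) (e : rel T)
    (H : wgraph R T) :
  (forall x y, wadj H x y ->
    (dist e x y < #|T|)%N /\ weight H [set x; y]%SET = (dist e x y)%:R) ->
  weighted_walk e (wwalk_le H).
Proof.
move=> Hw; split.
- by move=> u; exists [::]; split=> //; rewrite /walk_weight big_nil.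
- exact: wwalk_le_sym.
- move=> u v w m m' [p [ep <- wp]] [q [eq <- wq]]; exists (p ++ q).
  by rewrite cat_path ep eq last_cat walk_weight_cat natrD lerD.
- move=> u v m m' le [p [? ? wp]]; exists p; split=> //.
  by apply: le_trans wp _; rewrite ler_nat.
- move=> u v m [p [ep <- wp]]; have [m' mw] := walk_weight_nat Hw ep.
  by apply: walk_le_mono; rewrite -(ler_nat R) -mw.
Qed.

(** Each [u] in [A i] is joined to [S i u]. As [A k.+1] is empty, no climb is possible from level
    [k], and [stretch_level] leaves only its surplus bound. *)
Lemma levels_emulator (R : realType) (T : finType) (e : rel T) (k : nat)
    (A : nat -> {set T}) (S : nat -> T -> {set T}) :
  symmetric e -> A 0 = [set: T]%SET -> A k.+1 = finset.set0 ->
  (forall i u v, u \in A i -> v \in A i -> v \in S i u \/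
    exists2 w, w \in A i.+1 & (dist e u w <= dist e u v)%N /\ w \in S i u) ->
  exists H : wgraph R T,
  [/\ (#|edges H| <= \sum_(i < k.+1) \sum_(v in A i) #|S i v|)%N,
    forall u v, (gdist R e u v <= wdist H u v)%E &
    forall r u v, (dist e u v < #|T|)%N -> (dist e u v <= r ^ k)%N ->
      (wdist H u v <= (dist e u v + (stretch_bounds r k).1)%:R%:E)%E].
Proof.
move=> esym A0 Ak cover.
(* Loops are excluded, and so are unconnected pairs, whose [dist] is the default [#|T|]. *)
pose g : rel T := fun x y => [&& x != y, (dist e x y < #|T|)%N &
  [exists i : 'I_k.+1, (x \in A i) && (y \in S i x)]].
have gP x y : g x y -> x != y /\ (dist e x y < #|T|)%N by case/and3P.
have [H [EH WH]] := @distance_graph R T e g esym gP.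
have Hw x y : wadj H x y ->
    (dist e x y < #|T|)%N /\ weight H [set x; y]%SET = (dist e x y)%:R.
  move=> xy; have := edges_card2 xy; rewrite cards2; case: eqVneq => // nxy _.
  rewrite WH pair_weightE //; [|exact: dist_refl|by move=> *; exact: dist_sym].
  split=> //; move: xy; rewrite /wadj /= EH => /imsetP[[a b] /= /gP[_ dab] E].
  have : x \in [set a; b]%SET by rewrite -E set21.
  have : y \in [set a; b]%SET by rewrite -E set22.
  rewrite !inE => /orP[]/eqP ya /orP[]/eqP xa; move: nxy dab; rewrite ya xa ?eqxx //.
  by rewrite dist_sym.
have hh := wwalk_weighted_walk Hw.
have edge_walk x y : (dist e x y < #|T|)%N ->
    (exists2 i, (i <= k)%N & x \in A i /\ y \in S i x) ->
    wwalk_le H x y (dist e x y).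
  move=> dxy [i ik [xA yS]]; have [->|nxy] := eqVneq x y.
    by rewrite dist_refl; apply: ww_refl hh _.
  have xy : wadj H x y.
    rewrite /wadj /= EH; apply/imsetP; exists (x, y) => //.
    rewrite inE /= /g nxy dxy; apply/existsP.
    by exists (Ordinal (ik : i < k.+1)%N); rewrite /= xA yS.
  exists [:: y]; rewrite /= xy; split=> //.
  by rewrite /walk_weight /= big_seq1 /= (Hw _ _ xy).2.
have cov i u v m : (i <= k)%N -> u \in A i -> v \in A i -> walk_le e u v m ->
    wwalk_le H u v m \/ exists2 w, w \in A i.+1 & wwalk_le H u w m.
  move=> ik uA vA /walk_dist[dm duv]; have [vS|[w wA [dw wS]]] := cover i u v uA vA.
    by left; apply: (ww_mono hh) dm _; apply: edge_walk => //; exists i.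
  right; exists w => //; apply: (ww_mono hh) (leq_trans dw dm) _.
  by apply: edge_walk; [exact: leq_ltn_trans dw duv|exists i].
exists H; split.
- rewrite EH (leq_trans (leq_imset_card _ _)) //.
  rewrite (_ : #|_| = \sum_x #|[set y | g x y]|)%N; last first.
    rewrite -sum1_card (eq_bigl (fun xy => g xy.1 xy.2)) //.
    rewrite -(pair_big_dep xpredT g (fun _ _ => 1%N)) /=; apply: eq_bigr => x _.
    by rewrite sum1dep_card.
  rewrite [leqRHS](_ : _ = \sum_x \sum_(i < k.+1 | x \in A i) #|S i x|)%N.
    apply: leq_sum => x _.
    apply: leq_trans (_ : #|\bigcup_(i < k.+1 | x \in A i) S i x| <= _)%N.
      apply/subset_leq_card/fintype.subsetP => y; rewrite inE => /and3P[_ _].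
      by case/existsP => i /andP[xA yS]; apply/bigcupP; exists i.
    elim/big_rec2: _ => [|i m B _ IH]; first by rewrite cards0.
    by rewrite (leq_trans (leq_card_setU _ _)) // leq_add2l.
  by rewrite (exchange_big_dep xpredT).
- move=> u v; apply: le_ereal_inf_tmp => _ [p [ep lp] <-].
  have [m wm] := walk_weight_nat Hw ep; rewrite lp => um.
  have [dm dn] := walk_dist um.
  by rewrite gdistE dn wm lee_fin ler_nat.
- move=> r u v dn dr.
  have [[p [ep lp wp]]|[w]] := stretch_level esym hh A0 cov (leqnn k) dr (dist_walk dn).
    by apply: ge_ereal_inf; exists (walk_weight H u p)%:E; [exists p|rewrite lee_fin].
  by rewrite Ak inE.
Qed.

(** * The surplus as a function of the distance *)

Local Open Scope classical_set_scope.

(** After a shift by one, the terms are powers of the harmonic sequence, which tends to 0 from the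
    right. *)
Lemma cvg_root_inv (R : realType) (x : R) : 0 < x ->
  (n%:R `^ x)^-1 @[n --> \oo] --> (0 : R).
Proof.
move=> x0; rewrite -(cvg_shiftS (fun n => (n%:R `^ x)^-1 : R)) /=.
have /cvg_at_rightP := @powR_cvg0 R x x0.
move=> /(_ (@harmonic R)) H.
under eq_fun do rewrite -powR_inv1 ?powR_ge0 // powRAC powR_inv1 ?ler0n //.
by apply: H; split; [move=> n; exact: harmonic_gt0|exact: cvg_harmonic].
Qed.

(** For d > 0 let t = d^(1/k) and choose t < r <= t + 1. Then d <= r^k, and the surplus is at most
    r^(k-1) (4 k + c/r) <= (1 + t)^(k-1) (4 k + c/t). *)
Lemma stretch_error (R : realType) (k : nat) : (0 < k)%N ->
  exists eps : nat -> R, eps n @[n --> \oo] --> (0 : R) /\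
  forall d : nat, exists r : nat, (d <= r ^ k)%N /\
    ((stretch_bounds r k).1%:R <= (4 + eps d) * k%:R * d%:R `^ (1 - k%:R^-1) \/
      d = 0%N /\ 0 <= 4 + eps d).
Proof.
move=> k0; have [c cP] := stretch_bounds_asymp k.
have kR : (0 : R) < k%:R by rewrite ltr0n.
pose s (d : nat) : R := (d%:R `^ k%:R^-1)^-1.
(* This is (1 + t)^(k-1) (4 k + c/t) divided by k t^(k-1), less 4, with [s d] for 1/t. *)
exists (fun d => (1 + s d) ^+ k.-1 * (4 + c%:R / k%:R * s d) - 4); split.
  have s0 : s n @[n --> \oo] --> (0 : R) by apply: cvg_root_inv; rewrite invr_gt0.
  rewrite (_ : 0 = (1 + 0) ^+ k.-1 * (4 + c%:R / k%:R * 0) - 4 :> R); last first.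
    by rewrite addr0 mulr0 addr0 expr1n mul1r subrr.
  apply: cvgB; last exact: cvg_cst.
  apply: cvgM; last by apply: cvgD; [exact: cvg_cst|apply: cvgM; [exact: cvg_cst|]].
  have s1 : 1 + s n @[n --> \oo] --> (1 + 0 : R) by apply: cvgD; [exact: cvg_cst|].
  elim: k.-1 => [|m IH]; first exact: cvg_cst.
  under eq_fun do rewrite exprS; rewrite exprS; exact: cvgM.
case=> [|d].
  (* At distance 0 only a sign is claimed; [s 0] is the conventional inverse of 0, that is 0. *)
  exists 1%N; split=> //; right; split=> //.
  by rewrite /s powR0 ?invr_eq0 ?gt_eqF // invr0 !(addr0, mulr0) expr1n mul1r subrKC.
set t : R := d.+1%:R `^ k%:R^-1.
have t0 : 0 < t by rewrite powR_gt0.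
exists (Num.truncn t).+1; set r := (Num.truncn t).+1.
have /andP[rt tr] := truncn_itv (ltW t0); rewrite -/r in tr.
have rt1 : r%:R <= 1 + t by rewrite /r -natr1 addrC lerD2l.
have tk : t ^+ k = d.+1%:R.
  by rewrite -powR_mulrn ?(ltW t0) // -powRrM mulVf ?gt_eqF // powRr1.
split.
  by rewrite -(ler_nat R) natrX -tk lerXn2r ?nnegrE ?(ltW t0) // ltW.
left; have -> : d.+1%:R `^ (1 - k%:R^-1) = t ^+ k.-1.
  rewrite powRB ?implybT //; last by rewrite pnatr_eq0 implybT.
  rewrite powRr1 // -/t -tk -{1}(prednK k0) exprS mulrAC mulfV ?mul1r //.
  by rewrite gt_eqF.
rewrite (_ : s d.+1 = t^-1) // subrKC.
have [+ _] := cP r isT; rewrite -(ler_nat R) !natrM !natrX natrD !natrM => H.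
have r0 : 0 < r%:R :> R by rewrite ltr0n.
have H1 : (stretch_bounds r k).1%:R <= r%:R ^+ k.-1 * (4 * k%:R + c%:R / r%:R) :> R.
  rewrite -(ler_pM2l (exprn_gt0 2 r0)); apply: le_trans H _.
  rewrite -{1}(prednK k0) exprS le_eqVlt; apply/orP; left; apply/eqP.
  by field; rewrite gt_eqF.
apply: le_trans H1 _.
have -> : (1 + t^-1) ^+ k.-1 * (4 + c%:R / k%:R * t^-1) * k%:R * t ^+ k.-1
   = (1 + t) ^+ k.-1 * (4 * k%:R + c%:R / t).
  have -> : 1 + t = (1 + t^-1) * t by field; rewrite gt_eqF.
  by rewrite exprMn; field; rewrite !gt_eqF.
apply: ler_pM.
- by rewrite exprn_ge0 // ltW.
- by rewrite addr_ge0 // ?mulr_ge0 // ?divr_ge0 // ltW.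
- by rewrite lerXn2r ?nnegrE // ?addr_ge0 // ltW.
- by rewrite lerD2l ler_wpM2l // lef_pV2 ?posrE // ltW.
Qed.

(** * Level sizes and the number of edges *)

(* The factor [2 ^- i] makes the levels contribute geometrically decreasing
   numbers of edges, so that the constant does not depend on [k]. *)
Definition level_size (R : realType) (n k i : nat) : R :=
  n%:R `^ (1 - (2 ^+ i - 1) / (2 ^+ k.+1 - 1)) / 2 ^+ i.

Lemma level_size_gt0 (R : realType) (n k i : nat) : (0 < n)%N ->
  0 < level_size R n k i.
Proof.
by move=> n0; rewrite divr_gt0 ?exprn_gt0 // powR_gt0 // ltr0n.
Qed.

(** The exponents q_i of [n] in [level_size] satisfy 2 q_i - q_(i+1) = 1 + 1/(2^(k+1) - 1), so every
    level meets the same power N of [n]: the quotient gives at most 4 N / 2^i and [m] at most N /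
    2^i. *)
Lemma level_edges (R : realType) (n k i : nat) (m : R) : (0 < n)%N ->
  0 <= m -> m <= level_size R n k i ->
  2 * m ^+ 2 / level_size R n k i.+1 + m <=
  5 / 2 ^+ i * n%:R `^ (1 + (2 ^+ k.+1 - 1)^-1).
Proof.
move=> n0 m0 mi; set nu : R := (2 ^+ k.+1 - 1)^-1; set N := n%:R `^ (1 + nu).
have nu0 : 0 < nu by rewrite invr_gt0 subr_gt0 exprn_egt1 // ltr1n.
have n1 : 1 <= n%:R :> R by rewrite ler1n.
have nR : 0 < n%:R :> R by rewrite ltr0n.
have p0 : 0 < 2 ^+ i :> R by rewrite exprn_gt0.
have p1 : 1 <= 2 ^+ i :> R by rewrite exprn_ege1 // ler1n.
pose q : R := 1 - (2 ^+ i - 1) * nu.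
pose q' : R := 1 - (2 ^+ i.+1 - 1) * nu.
have aE : level_size R n k i = n%:R `^ q / 2 ^+ i by [].
have a'E : level_size R n k i.+1 = n%:R `^ q' / (2 * 2 ^+ i) by rewrite -exprS.
have main : n%:R `^ q ^+ 2 = N * n%:R `^ q'.
  have nz : n%:R != 0 :> R by rewrite gt_eqF.
  rewrite expr2 /N -!powRD ?nz ?implybT //; congr (_ `^ _).
  by rewrite /q /q' exprS; ring.
have qN : n%:R `^ q <= N.
  apply: ler_powR => //; rewrite /q.
  have : 0 <= (2 ^+ i - 1) * nu by rewrite mulr_ge0 ?subr_ge0 // ltW.
  by lra.
have m2 : m ^+ 2 <= (n%:R `^ q / 2 ^+ i) ^+ 2.
  by rewrite lerXn2r ?nnegrE // -aE // (le_trans m0).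
have q'0 : 0 < n%:R `^ q' by rewrite powR_gt0.
have -> : 5 / 2 ^+ i * N =
    2 * ((n%:R `^ q / 2 ^+ i) ^+ 2) / level_size R n k i.+1 + N / 2 ^+ i.
  by rewrite expr_div_n main a'E; field; rewrite !gt_eqF.
apply: lerD.
  by rewrite ler_pM2r ?invr_gt0 ?level_size_gt0 // ler_pM2l.
by apply: (le_trans mi); rewrite aE ler_pM2r ?invr_gt0.
Qed.

Lemma sum_half_pow_le2 (R : realType) (m : nat) :
  \sum_(i < m) (2 ^+ i)^-1 <= 2 :> R.
Proof.
suff -> : \sum_(i < m) (2 ^+ i)^-1 = 2 - 2 / 2 ^+ m :> R.
  by rewrite gerBl divr_ge0 // exprn_ge0.
elim: m => [|m IH]; first by rewrite big_ord0 expr0; lra.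
by rewrite big_ord_recr /= IH exprS; field; rewrite expf_neq0.
Qed.

(** * Sparse emulators of sublinear stretch *)

Lemma sublinear_emulator (R : realType) (T : finType) (e : rel T) (k : nat) :
  (0 < #|T|)%N -> symmetric e ->
  exists H : wgraph R T,
  [/\ #|edges H|%:R <= 10 * #|T|%:R `^ (1 + (2 ^+ k.+1 - 1)^-1) :> R,
    forall u v, (gdist R e u v <= wdist H u v)%E &
    forall r u v, (dist e u v < #|T|)%N -> (dist e u v <= r ^ k)%N ->
      (wdist H u v <= (dist e u v + (stretch_bounds r k).1)%:R%:E)%E].
Proof.
move=> n0 esym; set N := (X in 10 * X).
have [||A [S [A0 Asize Ssize cover]]] := @hierarchy R T (dist e) (level_size R #|T| k).
- by move=> i; exact: level_size_gt0.
- by rewrite /level_size expr0 subrr mul0r subr0 powRr1 // divr1.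
(* At [k.+1] the exponent is 0, so the size is at most 1 / 2^(k+1) < 1. *)
have Ak : A k.+1 = finset.set0.
  apply/eqP; rewrite -cards_eq0 -leqn0 -ltnS -(ltr_nat R).
  apply: le_lt_trans (Asize k.+1) _; rewrite /level_size divff; last first.
    by rewrite subr_eq0 gt_eqF // exprn_egt1 // ltr1n.
  by rewrite subrr powRr0 div1r invf_lt1 ?exprn_gt0 // exprn_egt1 // ltr1n.
have [H [cH lowH upH]] := levels_emulator R esym A0 Ak cover.
exists H; split=> //.
apply: (@le_trans _ _ (\sum_(i < k.+1) \sum_(v in A i) #|S i v|)%N%:R).
  by rewrite ler_nat.
apply: (@le_trans _ _ (\sum_(i < k.+1) 5 / 2 ^+ i * N)).
  rewrite natr_sum; apply: ler_sum => i _; apply: le_trans (Ssize i) _.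
  by apply: level_edges => //; exact: Asize.
(* The 10 is 5 times the bound 2 on the geometric sum. *)
rewrite -mulr_suml -mulr_sumr ler_wpM2r ?powR_ge0 //.
by have := sum_half_pow_le2 R k.+1; lra.
Qed.

Theorem theorem2 (R : realType) :
  exists C : R, forall k : nat, (1 <= k)%N ->
  exists eps : nat -> R, eps n @[n --> \oo] --> (0 : R) /\
  forall (n : nat) (T : finType) (e : rel T),
    #|T| = n -> symmetric e -> irreflexive e ->
  exists H : wgraph R T,
    #|edges H|%:R <= C * n%:R `^ (1 + (2 ^+ k.+1 - 1)^-1) /\
    emulator e H
      (fun d => d%:R + (4 + eps d) * k%:R * d%:R `^ (1 - k%:R^-1)).
Proof.
exists 10 => k k0; have [eps [eps0 epsP]] := stretch_error R k0.
exists eps; split=> // n T e <- esym _.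
(* The hierarchy is built for at least one vertex; the empty graph gets no edges. *)
have [T0|Tgt0] := posnP #|T|.
  have noT (x : T) : False by have := fintype0 x; rewrite T0 => /(_ erefl).
  have [|H [EH _]] := @distance_graph R T e (fun _ _ => false) esym; first by [].
  exists H; split; last by move=> u.
  rewrite EH (_ : #|_| = 0)%N ?mulr_ge0 ?powR_ge0 //.
  by apply: eq_card0 => a; apply/negP => /imsetP[[x]]; have := noT x.
have [H [cH lowH upH]] := @sublinear_emulator R T e k Tgt0 esym.
exists H; split=> // u v; split=> // d; rewrite gdistE.
case: ifP => // dn [/eqP]; rewrite eqr_nat => /eqP dE.
have [r [dr [err|[d0 eps_ge]]]] := epsP d.
  have := upH r u v dn; rewrite dE => /(_ dr) /le_trans; apply.
  by rewrite lee_fin natrD lerD2l.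
(* At distance 0 the ends coincide and the empty walk costs 0. *)
rewrite d0 in dE eps_ge *.
have [p [_ lp]] := dist_walk dn; rewrite dE leqn0 size_eq0 => /eqP p0.
move: lp; rewrite p0 /= => <-.
apply: ge_ereal_inf; exists (walk_weight H u [::])%:E; first by exists [::].
by rewrite lee_fin /walk_weight big_nil add0r !mulr_ge0 ?powR_ge0.
Qed.
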